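(* Let $n\ge 2$ and let $\mathbf r=(r_1,\ldots,r_n)\in\mathcal R$. Then the Poincaré exponent $\delta(\mathbf r)$ of the free group $F_n$ satisfies the equation $\lambda\circ H(\mathbf r,s)=0$ for $s=\delta(\mathbf r)$. More precisely, $\delta(\mathbf r)$ is the unique solution $s\in(0,1)$ of the equation \[ \sum_{m=1}^{n}(2m-1)\sum_{1\le i_1<i_2<\cdots<i_m\le n}(r_{i_1}r_{i_2}\cdots r_{i_m})^s=1, \] that is, \[ \sum_{i}r_{i}^s+3\sum_{i_{1}<i_{2}}(r_{i_{1}}r_{i_{2}})^s+5\sum_{i_{1}<i_{2}<i_{3}}(r_{i_{1}}r_{i_{2}}r_{i_{3}})^s+\cdots+(2n-1)(r_{1}\cdots r_{n})^s=1 . \]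
   Context: $F_n=\langle a_1,\ldots,a_n\rangle$ is the free group of rank $n\ge2$ and $\mathrm{Cay}(F_n)$ its Cayley graph (the $2n$-regular tree with vertex set $F_n$, where $x$ is adjacent to $xa_i^{\pm1}$). $\mathcal R=\{\mathbf r=(r_1,\ldots,r_n)\mid r_1+\cdots+r_n=1/2,\ r_i>0\ \forall i\}$. For $\mathbf r\in\mathcal R$, $d_{\mathbf r}$ is the path metric on $\mathrm{Cay}(F_n)$ in which each edge $\{x,xa_i^{\pm1}\}$ has length $-\log r_i$. The Poincaré exponent of $F_n$ is \[ \delta(\mathbf r)=\limsup_{R\to\infty}\frac{\log\#\{g\in F_n\mid d_{\mathbf r}(\mathrm{id},g)\le R\}}{R}. \] $H:\mathcal R\times(0,\infty)\to(0,1)^n$ is the diffeomorphism $H(\mathbf r,s)=(r_1^s,\ldots,r_n^s)$. For $\mathbf u=(u_1,\ldots,u_n)\in(0,1)^n$, \[ \lambda(\mathbf u)=\frac{\sum_{j}(1-u_j)\prod_{k\ne j}(u_k^{-1}-u_k)-\frac12\prod_{\ell}(u_\ell^{-1}-u_\ell)}{\sum_j\prod_{k\neq j}(u_k^{-1}-u_k)}. \] *)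

(* Defs.v *)
From HB Require Import structures.
From mathcomp Require Import all_boot all_order all_algebra.
From mathcomp Require Import all_classical all_reals all_analysis.
Set Implicit Arguments.
Unset Strict Implicit.
Unset Printing Implicit Defensive.
Import Order.TTheory GRing.Theory Num.Theory.
Import numFieldNormedType.Exports.
Local Open Scope classical_set_scope.
Local Open Scope ring_scope.

Section FreeGroup.
Variable n : nat.

(* The letter (i, false) stands for a_i and (i, true) for its inverse. *)
Definition letter : Type := ('I_n * bool)%type.

Definition linv (l : letter) : letter := (l.1, ~~ l.2).

Definition reduced (w : seq letter) : bool :=
  sorted (fun l m => m != linv l) w.

Record freegroup : Type :=
  FreeGroup { fword : seq letter; fwordP : reduced fword }.

HB.instance Definition _ := [isSub for fword].
HB.instance Definition _ := [Countable of freegroup by <:].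

(* The reduced form of l :: w, for w reduced. *)
Definition lpush (l : letter) (w : seq letter) : seq letter :=
  if w is m :: w' then if m == linv l then w' else l :: w else [:: l].

Lemma linvK : involutive linv.
Proof. by case=> i b; rewrite /linv /= negbK. Qed.

Lemma linv_neq l : l != linv l.
Proof. by apply/eqP => /(congr1 snd) /=; case: (l.2). Qed.

Lemma lpush_reduced l w : reduced w -> reduced (lpush l w).
Proof.
case: w => [|m w] //= mw; case: eqVneq => [_|ml] /=.
  exact: path_sorted mw.
by rewrite ml mw.
Qed.

Lemma lpushK l w : reduced w -> lpush (linv l) (lpush l w) = w.
Proof.
case: w => [|m w] /=; first by rewrite linvK eqxx.
case: eqVneq => [->|ml] /= mw; last by rewrite linvK eqxx.
by case: w mw => [|k w] //= /andP[/negPf -> _].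
Qed.

Lemma lpushVK l w : reduced w -> lpush l (lpush (linv l) w) = w.
Proof. by move=> rw; rewrite -{1}(linvK l) lpushK. Qed.

Definition wmul (v w : seq letter) : seq letter := foldr lpush w v.

Definition winv (w : seq letter) : seq letter := rev (map linv w).

Lemma wmul_reduced v w : reduced w -> reduced (wmul v w).
Proof. by move=> rw; elim: v => //= l v; apply: lpush_reduced. Qed.

Lemma winv_reduced w : reduced w -> reduced (winv w).
Proof.
rewrite /reduced /winv rev_sorted sorted_map; apply: sub_sorted => l m /=.
by rewrite (inj_eq (inv_inj linvK)); apply: contra => /eqP ->; rewrite linvK.
Qed.

Lemma lpush_wmul l v w : reduced w ->
  wmul (lpush l v) w = lpush l (wmul v w).
Proof.
case: v => [|m v] //= rw; case: eqVneq => [->|_] //=.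
by rewrite lpushVK // wmul_reduced.
Qed.

Lemma wmulA u v w : reduced w -> wmul u (wmul v w) = wmul (wmul u v) w.
Proof. by move=> rw; elim: u => //= l u ->; rewrite lpush_wmul. Qed.

Lemma wmul1 w : reduced w -> wmul w [::] = w.
Proof.
elim: w => //= l w IH lw; rewrite (IH (path_sorted lw)).
by case: w lw {IH} => //= m w /andP[/negPf -> _].
Qed.

Lemma wmulV w : reduced w -> wmul (winv w) w = [::].
Proof.
elim: w => //= l w IH lw; have rw := path_sorted lw.
rewrite /winv /= rev_cons /wmul foldr_rcons /= linvK eqxx.
exact: IH.
Qed.

Definition fone : freegroup := @FreeGroup [::] isT.
Definition fmul (x y : freegroup) : freegroup :=
  FreeGroup (wmul_reduced (fword x) (fwordP y)).
Definition finv (x : freegroup) : freegroup :=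
  FreeGroup (winv_reduced (fwordP x)).

Lemma fmulA : associative fmul.
Proof. by move=> x y z; apply/val_inj; rewrite /= wmulA // fwordP. Qed.
Lemma fmul1x : left_id fone fmul.
Proof. by move=> x; apply/val_inj. Qed.
Lemma fmulx1 : right_id fone fmul.
Proof. by move=> x; apply/val_inj; rewrite /= wmul1 // fwordP. Qed.
Lemma fmulVx : left_inverse fone finv fmul.
Proof. by move=> x; apply/val_inj; rewrite /= wmulV // fwordP. Qed.
Lemma fmulxV : right_inverse fone finv fmul.
Proof.
move=> x; have finvK : finv (finv x) = x.
  apply/val_inj; rewrite /= /winv map_rev revK -map_comp.
  by apply: map_id_in => l _ /=; rewrite linvK.
by rewrite -{1}finvK fmulVx.
Qed.

HB.instance Definition _ :=
  isGroup.Build freegroup fmulA fmul1x fmulx1 fmulVx fmulxV.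

Definition gen (i : 'I_n) : freegroup := @FreeGroup [:: (i, false)] isT.

End FreeGroup.

Section Cayley.
Variables (R : realType) (n : nat).
Implicit Types (r u : 'I_n -> R) (x y z : freegroup n).

Definition cay_adj (i : 'I_n) x y : Prop :=
  y = (x * gen i)%g \/ y = (x * (gen i)^-1)%g.

(* cay_path r x y l: some edge path from x to y in Cay(F_n) has length l. *)
Inductive cay_path r : freegroup n -> freegroup n -> R -> Prop :=
| cay_path_nil x : cay_path r x x 0
| cay_path_cons x y z i l :
    cay_adj i x y -> cay_path r y z l -> cay_path r x z (- ln (r i) + l).

Definition cay_dist r x y : R := inf [set l | cay_path r x y l].

Definition cay_ball r (t : R) : set (freegroup n) :=
  [set g | cay_dist r 1%g g <= t].

(* The extended-real counting and lne take no junk value here, whether or not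
   the ball is known to be finite; for r in the simplex it is finite. *)
Definition poincare_exponent r : \bar R :=
  limf_esup (fun t : R => (lne (counting (cay_ball r t)) * (t^-1)%:E)%E)
    (pinfty_nbhs R).

Definition simplex r : Prop :=
  \sum_(i < n) r i = 2^-1 /\ forall i, 0 < r i.

Definition powmap r (s : R) : 'I_n -> R := fun i => r i `^ s.

Definition lambda u : R :=
  (\sum_(j < n) (1 - u j) * \prod_(k < n | k != j) ((u k)^-1 - u k)
     - 2^-1 * \prod_(l < n) ((u l)^-1 - u l))
  / \sum_(j < n) \prod_(k < n | k != j) ((u k)^-1 - u k).

(* An index set i_1 < ... < i_m is a subset I of 'I_n of cardinal m. *)
Definition sym_equation r (s : R) : Prop :=
  \sum_(1 <= m < n.+1) (2 * m - 1)%:R *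
    \sum_(I : {set 'I_n} | #|I| == m) (\prod_(i in I) r i) `^ s = 1.

End Cayley.

(* Main.v *)
(* Put u_i = r_i^s.  Expanding the products over subsets of indices, both
   lambda(u) = 0 and the symmetric equation reduce to
   sum_i u_i / (1 + u_i) = 1/2, whose left-hand side decreases strictly with s
   from n/2 at s = 0 to a value below 1/2 at s = 1.  At its root s, let N_l(t)
   count the words of length at most t that may follow the letter l in a reduced
   word.  For t >= 0, N_l(t) = 1 + sum_{m <> l^-1} N_m(t + log r_m), and
   exp(s t) / (1 + u_l) solves the corresponding homogeneous equation.  An
   induction comparing the two shows that N_l(t) is exp(s t) up to
   multiplicative constants, so the Poincare exponent is s. *)
Require Import Defs.
From mathcomp Require Import all_boot all_order all_algebra.
From mathcomp Require Import all_classical all_reals all_analysis.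
From mathcomp Require Import finmap zify ring lra.
Set Implicit Arguments.
Unset Strict Implicit.
Unset Printing Implicit Defensive.
Import Order.TTheory GRing.Theory Num.Theory.
Import numFieldNormedType.Exports.
Local Open Scope classical_set_scope.
Local Open Scope ring_scope.

Definition critical_sum (R : realType) (n : nat) (r : 'I_n -> R) (s : R) : R :=
  \sum_(i < n) r i `^ s / (1 + r i `^ s).

(* Adding this constant to the counting functions makes their renewal equation
   homogeneous, since each letter has [2n - 1] admissible successors. *)
Definition renewal_shift (R : realType) (n : nat) : R := (n.*2 - 2)%:R^-1.

Lemma renewal_shift_gt0 (R : realType) n : (1 < n)%N -> 0 < renewal_shift R n.
Proof. by move=> n_gt1; rewrite invr_gt0 ltr0n; lia. Qed.

(** * Edge paths in the Cayley tree and lengths of reduced words *)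

Section WordLength.
Variables (R : realType) (n : nat) (r : 'I_n -> R).
Hypothesis r_simplex : simplex r.

Definition word_length (w : seq (letter n)) : R := \sum_(l <- w) - ln (r l.1).

(** The other coordinates are positive, so [r i] is at most 1/2. This uniform bound limits the
    number of letters in a word of given length. *)
Lemma ln2_le_edge i : ln 2 <= - ln (r i).
Proof.
have [sum_r r_gt0] := r_simplex.
have r_le : r i <= 2^-1.
  by rewrite -sum_r (bigD1 i) //= lerDl sumr_ge0 // => j _; apply: ltW.
rewrite -[leLHS]opprK lerN2 -lnV ?posrE // ler_ln ?posrE ?invr_gt0 //.
Qed.

Lemma edge_ge0 i : 0 <= - ln (r i).
Proof. by apply: le_trans (ln2_le_edge i); rewrite ln_ge0 // ler1n. Qed.

Lemma word_length_cons l w : word_length (l :: w) = - ln (r l.1) + word_length w.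
Proof. exact: big_cons. Qed.

Lemma word_length_ge0 w : 0 <= word_length w.
Proof. by apply: sumr_ge0 => l _; apply: edge_ge0. Qed.

Lemma size_le_word_length w : (size w)%:R * ln 2 <= word_length w.
Proof.
elim: w => [|l w IH]; first by rewrite mul0r /word_length big_nil.
by rewrite word_length_cons /= -natr1 mulrDl mul1r addrC lerD // ln2_le_edge.
Qed.

Lemma word_length_lpush l w :
  word_length (lpush l w) <= - ln (r l.1) + word_length w.
Proof.
case: w => [|m w] /=; first by rewrite word_length_cons.
case: eqP => _; rewrite !word_length_cons // addrA lerDr.
by rewrite addr_ge0 ?edge_ge0.
Qed.

Lemma word_length_wmul v w :
  word_length (wmul v w) <= word_length v + word_length w.
Proof.
elim: v => [|l v IH] /=; first by rewrite {2}/word_length big_nil add0r.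
apply: le_trans (word_length_lpush _ _) _.
by rewrite word_length_cons -addrA lerD2l.
Qed.

Lemma cay_path_translate (x y z : freegroup n) t :
  cay_path r y z t -> cay_path r (x * y)%g (x * z)%g t.
Proof.
elim=> [u|u v p i l adj _ IH]; first exact: cay_path_nil.
apply: cay_path_cons IH; case: adj => ->; rewrite mulgA; by [left|right].
Qed.

Lemma cay_path_word w (rw : reduced w) :
  cay_path r 1%g (FreeGroup rw) (word_length w).
Proof.
elim: w rw => [|l w IH] lw.
  have -> : FreeGroup lw = 1%g by apply: val_inj.
  by rewrite /word_length big_nil; apply: cay_path_nil.
have rw : reduced w := path_sorted lw.
pose x : freegroup n := @FreeGroup n [:: l] isT.
have -> : FreeGroup lw = (x * FreeGroup rw)%g.
  apply: val_inj => /=; case: (w) lw => //= m w' /andP[/negPf -> _] //.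
rewrite word_length_cons; apply: (@cay_path_cons _ _ _ _ x).
  by rewrite /cay_adj !mul1g {}/x; case: l {lw} => i [];
    [right|left]; apply: val_inj.
by rewrite -{1}[x]mulg1; apply/cay_path_translate/IH.
Qed.

(** Along a path, [x^-1 * y] is the product of the letters of its edges, and free reduction only
    deletes letters of nonnegative length. *)
Lemma cay_path_ge (x y : freegroup n) t :
  cay_path r x y t -> word_length (fword (x^-1 * y)%g) <= t.
Proof.
elim=> [u|u v p i l adj _ IH]; first by rewrite mulVg /word_length big_nil.
have -> : (u^-1 * p = (u^-1 * v) * (v^-1 * p))%g.
  by rewrite -mulgA mulVKg.
apply: le_trans (word_length_wmul _ _) _; apply: lerD IH.
by case: adj => ->; rewrite mulKg /= /word_length big_seq1.
Qed.

Lemma cay_dist_word (g : freegroup n) :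
  cay_dist r 1%g g = word_length (fword g).
Proof.
have pg : cay_path r 1%g g (word_length (fword g)).
  by case: g => w rw; apply: cay_path_word.
have lb : lbound [set l | cay_path r 1%g g l] (word_length (fword g)).
  by move=> l /cay_path_ge; rewrite invg1 mul1g.
apply/eqP; rewrite eq_le; apply/andP; split.
  by apply: ge_inf => //; exists (word_length (fword g)).
by apply: lb_le_inf => //; exists (word_length (fword g)).
Qed.

(** The fuel [k] makes the recursion structural and bounds the number of letters; [l] is the letter
    before the word and [t] the remaining length budget. *)
Fixpoint short_words k (l : letter n) t : seq (seq (letter n)) :=
  if k is k'.+1 then
    if t < 0 then [::] else
    [::] :: [seq m :: v | m <- enum [pred m | m != linv l],
                          v <- short_words k' m (t + ln (r m.1))]
  else [::].

Lemma mem_short_words k l t w :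
  (w \in short_words k l t) =
  [&& path (fun a b => b != linv a) l w, (size w < k)%N & word_length w <= t].
Proof.
elim: k l t w => [|k IH] l t w /=; first by rewrite andbF.
case: ltP => [t0|t0].
  by rewrite !leNgt (lt_le_trans t0) ?word_length_ge0 // !andbF.
case: w => [|m w] /=.
  by rewrite in_cons eqxx /word_length big_nil t0.
rewrite in_cons /= ltnS word_length_cons -lerBrDl opprK.
apply/allpairsPdep/idP => [[a [b [+ + [-> ->]]]]|/andP[/andP[ml pw] /andP[sw dw]]].
  by rewrite mem_enum inE IH => -> /and3P[-> -> ->].
by exists m, w; rewrite mem_enum inE ml IH pw sw dw.
Qed.

Lemma short_words_uniq k l t : uniq (short_words k l t).
Proof.
elim: k l t => //= k IH l t; case: ifP => //= _; apply/andP; split.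
  by apply/negP => /allpairsPdep[a [b []]].
apply: allpairs_uniq_dep => [|m _|]; [exact: enum_uniq|exact: IH|].
by move=> [a b] [c d] _ _ /= [-> ->].
Qed.

Lemma size_short_words k l t : 0 <= t ->
  size (short_words k.+1 l t) =
  (\sum_(m | m != linv l) size (short_words k m (t + ln (r m.1))%R)).+1.
Proof.
move=> t0; rewrite /= ltNge t0 /= size_allpairs_dep sumnE big_map.
by rewrite big_enum.
Qed.


(** * The renewal equation at the critical exponent *)

Section Renewal.
Local Notation D := (renewal_shift R n).
Variable s : R.
Hypothesis s_gt0 : 0 < s.
Hypothesis s_critical : critical_sum r s = 2^-1.
Hypothesis n_gt1 : (1 < n)%N.

Definition edge_weight (l : letter n) : R := r l.1 `^ s.
(** At the critical [s], this is the mass of the ends not beginning with [linv l], for the boundary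
    measure giving the cylinder of each letter [m] mass [edge_weight m * shadow m]. *)
Definition shadow (l : letter n) : R := (1 + edge_weight l)^-1.

Lemma edge_weightE l : edge_weight l = expR (s * ln (r l.1)).
Proof.
have [_ r_gt0] := r_simplex.
by rewrite /edge_weight -{1}[r l.1]lnK ?posrE // -expRM mulrC.
Qed.

Lemma edge_weight_expR l t :
  edge_weight l * expR (s * t) = expR (s * (t + ln (r l.1))).
Proof. by rewrite edge_weightE -expRD; congr expR; ring. Qed.

Lemma sum_letter (F : 'I_n -> R) : \sum_(l : letter n) F l.1 = 2 * \sum_i F i.
Proof.
rewrite -(pair_big xpredT xpredT (fun i _ => F i)) /= mulr_sumr.
by apply: eq_bigr => i _; rewrite big_bool /= mulr_natl.
Qed.

(** By [s_critical] the sum over all letters is 1; dropping [linv l], whose weight [u] is that of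
    [l], leaves [1 - u / (1 + u) = 1 / (1 + u)]. *)
Lemma sum_shadow l :
  \sum_(m | m != linv l) edge_weight m * shadow m = shadow l.
Proof.
have w0 m : 0 <= edge_weight m by apply: powR_ge0.
have : \sum_m edge_weight m * shadow m = 1.
  rewrite (sum_letter (fun i => r i `^ s * (1 + r i `^ s)^-1)).
  by rewrite -/(critical_sum r s) s_critical mulfV.
rewrite (bigD1 (linv l)) //= => E.
have {E} := congr1 (fun z => z - edge_weight l * shadow l) E.
rewrite addrAC {1 2}/shadow {1 2}/edge_weight /= subrr add0r => ->.
have : 1 + edge_weight l != 0 by rewrite gt_eqF // ltr_pwDl.
by rewrite /shadow => h; field.
Qed.

Lemma shadow_bounds l : 2^-1 <= shadow l <= 1.
Proof.
have u0 : 0 <= edge_weight l by apply: powR_ge0.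
have u1 : edge_weight l <= 1.
  rewrite edge_weightE -expR0 ler_expR pmulr_rle0 // -oppr_ge0.
  exact: edge_ge0.
have u2 : 0 < 1 + edge_weight l by lra.
rewrite /shadow lef_pV2 ?posrE ?invf_le1 //; apply/andP; split; lra.
Qed.

Lemma sum_short_words k l t : 0 <= t ->
  (size (short_words k.+1 l t))%:R + D =
  \sum_(m | m != linv l) ((size (short_words k m (t + ln (r m.1))))%:R + D).
Proof.
move=> t0; rewrite size_short_words // big_split /= sumr_const.
have -> : #|[pred m | m != linv l]| = (n.*2 - 1)%N.
  by rewrite (cardC1 (linv l)) card_prod card_ord card_bool muln2 subn1.
rewrite -natr1 natr_sum -addrA; congr (_ + _).
have n2 : (2 <= n.*2)%N by lia.
have -> : (n.*2 - 1 = (n.*2 - 2).+1)%N by lia.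
(* As [D = 1 / (2n - 2)], the [2n - 1] copies of [D] make [1 + D], whose 1 is the empty word. *)
rewrite mulrS addrC -mulr_natr mulVf //.
by rewrite pnatr_eq0; lia.
Qed.

(* By [sum_short_words] and [sum_shadow], both [size (short_words ...) + D] and
   any multiple of [shadow l * expR (s * t)] satisfy the same renewal equation,
   so they only need to be compared on a bounded range of [t < 0]. *)
Lemma short_words_le k l t : - \sum_i - ln (r i) <= t ->
  (size (short_words k l t))%:R + D <=
  2 * D * expR (s * \sum_i - ln (r i)) * shadow l * expR (s * t).
Proof.
set M := \sum_i _.
(* Where the list is empty only [D] has to be dominated: [expR (s * M)] offsets [expR (s * t')] down
   to [t' = - M], and the factor 2 offsets [shadow l'], which is at least 1/2. *)
have base l' t' : - M <= t' ->
    D <= 2 * D * expR (s * M) * shadow l' * expR (s * t').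
  move=> tM; have /andP[q1 q2] := shadow_bounds l'.
  have e1 : 1 <= expR (s * M) * expR (s * t').
    rewrite -expRD -mulrDr -expR0 ler_expR mulr_ge0 ?(ltW s_gt0) //; lra.
  have q3 : 1 <= 2 * shadow l' by lra.
  have := mulr_ege1 q3 e1; rewrite -(ler_pM2l (renewal_shift_gt0 R n_gt1)); lra.
elim: k l t => [|k IH] l t tM; first by rewrite add0r base.
have [t0|t0] := ltP t 0; first by rewrite /= t0 add0r base.
rewrite sum_short_words // -sum_shadow mulr_sumr mulr_suml.
apply: ler_sum => m _; apply: le_trans (IH _ _ _) _.
  (* One letter costs at most [M], so a budget [t >= 0] does not fall below [- M]. *)
  have : - ln (r m.1) <= M.
    by rewrite /M (bigD1 m.1) //= lerDl sumr_ge0 // => i _; apply: edge_ge0.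
  lra.
by rewrite -edge_weight_expR; lra.
Qed.

Lemma short_words_ge k l t : t < k%:R * ln 2 ->
  D * shadow l * expR (s * t) <= (size (short_words k l t))%:R + D.
Proof.
have base l' t' : t' < 0 -> D * shadow l' * expR (s * t') <= D.
  move=> t0; have /andP[q1 q2] := shadow_bounds l'.
  rewrite -mulrA ger_pMr ?(renewal_shift_gt0 R n_gt1) // mulr_ile1 ?expR_ge0 //; first lra.
  by rewrite -expR0 ler_expR pmulr_rle0 // ltW.
(* Each letter costs at least [ln 2], so the bound [tk] passes to the recursive calls; at [k = 0] it
   forces [t < 0], so the fuel never runs out before the budget. *)
elim: k l t => [|k IH] l t tk.
  by rewrite add0r base // -[ltRHS](mul0r (ln 2)).
have [t0|t0] := ltP t 0; first by rewrite /= t0 add0r base.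
rewrite sum_short_words // -sum_shadow mulr_sumr mulr_suml.
apply: ler_sum => m _; apply: le_trans (IH _ _ _); last first.
  by have := ln2_le_edge m.1; rewrite -natr1 in tk; lra.
by rewrite -edge_weight_expR; lra.
Qed.

End Renewal.

End WordLength.

(** * Subset expansions behind the symmetric equation and [lambda] *)

Section SubsetExpansion.
Variables (R : realType) (n : nat) (u : 'I_n -> R).
Implicit Type J : {set 'I_n}.

Lemma sum_subset_prod :
  \sum_(J : {set 'I_n}) \prod_(i in J) u i = \prod_i (1 + u i).
Proof.
under [RHS]eq_bigr do rewrite addrC.
by rewrite bigA_distr; apply: eq_bigr => J _; rewrite big_mkcond.
Qed.

Lemma sum_subset_prod_mem i :
  \sum_(J : {set 'I_n} | i \in J) \prod_(k in J) u k =
  u i * \prod_(k | k != i) (1 + u k).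
Proof.
(* Replacing the constant term 1 by 0 in the factor [k = i] kills exactly the subsets omitting
   [i]. *)
transitivity (\prod_k (u k + (k != i)%:R)); last first.
  rewrite (bigD1 i) //= eqxx addr0; congr (_ * _).
  by apply: eq_bigr => k ->; rewrite addrC.
rewrite bigA_distr [RHS](bigID [pred J : {set 'I_n} | i \in J]) /=.
rewrite [X in _ = _ + X]big1 => [|J iJ]; last first.
  by rewrite (bigD1 i) //= (negPf iJ) eqxx mul0r.
rewrite addr0; apply: eq_bigr => J iJ; rewrite big_mkcond; apply: eq_bigr => k _.
by case: ifPn => // kJ; case: eqVneq iJ kJ => // -> ->.
Qed.

Hypothesis u_gt0 : forall i, 0 < u i.

(** Double counting of pairs [i \in J]; equivalently, the derivative of the product of the
    [1 + x * u i] at [x = 1]. *)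
Lemma sum_card_subset_prod :
  \sum_(J : {set 'I_n}) #|J|%:R * \prod_(i in J) u i =
  (\sum_i u i / (1 + u i)) * \prod_i (1 + u i).
Proof.
transitivity (\sum_(J : {set 'I_n}) \sum_(i in J) \prod_(k in J) u k).
  by apply: eq_bigr => J _; rewrite sumr_const mulr_natl.
rewrite (exchange_big_dep xpredT) //= mulr_suml; apply: eq_bigr => i _.
rewrite sum_subset_prod_mem (bigD1 (P := xpredT) i) //=.
have : 1 + u i != 0 by rewrite gt_eqF // addr_gt0.
by move=> h; field.
Qed.

(** In the weight [2m - 1], the part [2m] is summed by [sum_card_subset_prod] and the part -1 by
    [sum_subset_prod]; the final [+ 1] makes up for the missing empty subset. *)
Lemma sum_symE :
  \sum_(1 <= m < n.+1) (2 * m - 1)%:R *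
    \sum_(J : {set 'I_n} | #|J| == m) \prod_(i in J) u i =
  (2 * (\sum_i u i / (1 + u i)) - 1) * \prod_i (1 + u i) + 1.
Proof.
(* Here the subtraction is in [R], so the term [m = 0] is -1; over the naturals [2 * m - 1] would
   truncate to 0. *)
pose F (m : nat) : R := (2 * m%:R - 1) *
  \sum_(J : {set 'I_n} | #|J| == m) \prod_(i in J) u i.
have -> : (2 * (\sum_i u i / (1 + u i)) - 1) * \prod_i (1 + u i) =
    \sum_(m < n.+1) F m.
  rewrite mulrBl mul1r -mulrA -sum_card_subset_prod -sum_subset_prod mulr_sumr.
  rewrite -sumrB (partition_big (fun J => inord #|J| : 'I_n.+1) xpredT) //=.
  apply: eq_bigr => m _; rewrite /F mulr_sumr.
  have cardE J : (inord #|J| == m) = (#|J| == m :> nat).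
    by rewrite -val_eqE /= inordK // ltnS -[n in (_ <= n)%N]card_ord max_card.
  rewrite (eq_bigl _ _ cardE); apply: eq_bigr => J /eqP ->; ring.
rewrite -(big_mkord xpredT F) big_nat_recl // /F mulr0 sub0r.
rewrite (big_pred1 finset.set0) => [|J]; last by rewrite cards_eq0.
rewrite big_set0 mulr1 addrAC addNr add0r big_add1 /=; apply: eq_big_nat => m _.
by congr (_ * _); rewrite natrB ?muln_gt0 // natrM.
Qed.

(** Since [u / (1 + u) * (u^-1 - u) = 1 - u], replacing 1/2 by the sum in the hypothesis makes the
    numerator cancel term by term. *)
Lemma lambda_eq0 : (forall i, u i < 1) -> \sum_i u i / (1 + u i) = 2^-1 ->
  lambda u = 0.
Proof.
move=> u_lt1 uE; rewrite /lambda [X in X / _](_ : _ = 0) ?mul0r //.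
apply/eqP; rewrite subr_eq0 -uE mulr_suml; apply/eqP/eq_bigr => j _.
rewrite [in RHS](bigD1 j) //= mulrA; congr (_ * _).
have := u_gt0 j; have := u_lt1 j => u1 u0.
have ? : u j != 0 by rewrite gt_eqF.
have ? : 1 + u j != 0 by rewrite gt_eqF // addr_gt0.
by field; apply/andP.
Qed.

End SubsetExpansion.

(** * Existence and uniqueness of the critical exponent *)

Section CriticalExponent.
Variables (R : realType) (n : nat) (r : 'I_n -> R).
Hypothesis r_simplex : simplex r.
Hypothesis n_gt1 : (1 < n)%N.

Lemma powR_prod (I : finType) (P : pred I) (F : I -> R) s :
  (forall i, 0 <= F i) ->
  (\prod_(i | P i) F i) `^ s = \prod_(i | P i) F i `^ s.
Proof.
move=> F0.
suff [] : (\prod_(i | P i) F i) `^ s = \prod_(i | P i) F i `^ s /\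
  0 <= \prod_(i | P i) F i by [].
elim/big_rec2: _ => [|i x y _ [<- x0]]; first by rewrite powR1.
by rewrite powRM // mulr_ge0.
Qed.

Lemma sym_equationP s : sym_equation r s <-> critical_sum r s = 2^-1.
Proof.
have [_ r_gt0] := r_simplex.
rewrite /sym_equation.
have powE (J : {set 'I_n}) :
    (\prod_(i in J) r i) `^ s = \prod_(i in J) r i `^ s.
  by apply: powR_prod => i; apply: ltW.
under eq_bigr => m _ do rewrite (eq_bigr _ (fun J _ => powE J)).
have u0 i : 0 < r i `^ s by rewrite powR_gt0.
rewrite sum_symE // -/(critical_sum r s).
have q0 : \prod_i (1 + r i `^ s) != 0.
  by rewrite gt_eqF //; apply: prodr_gt0 => i _; rewrite addr_gt0.
split=> [|->]; last by rewrite mulfV ?subrr ?mul0r ?add0r // pnatr_eq0.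
move/(congr1 (fun z => z - 1)); rewrite addrK subrr => /eqP.
by rewrite mulf_eq0 (negPf q0) orbF subr_eq0 => /eqP h; lra.
Qed.

Lemma simplex_lt1 i : r i < 1.
Proof.
have [_ r_gt0] := r_simplex.
rewrite -[r i]lnK ?posrE // expR_lt1 -oppr_gt0.
by apply: lt_le_trans (ln2_le_edge r_simplex i); rewrite ln_gt0 // ltr1n.
Qed.

Lemma powR_simplexE i s : r i `^ s = expR (s * ln (r i)).
Proof. by have [_ /(_ i) r0] := r_simplex; rewrite mulrC expRM lnK. Qed.

Lemma critical_sum_decreasing : {homo critical_sum r : s t /~ s < t}.
Proof.
move=> s t st; rewrite /critical_sum.
apply: ltr_sum => [|i _].
  by apply/hasP; exists (Ordinal (ltnW n_gt1)) => //; rewrite mem_index_enum.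
have : r i `^ s < r i `^ t.
  have ln_r : ln (r i) < 0.
    by rewrite ln_lt0 // simplex_lt1 andbT; case: r_simplex.
  by rewrite !powR_simplexE ltr_expR ltr_nM2r.
have := powR_ge0 (r i) t; have := powR_ge0 (r i) s => s0 t0 h.
have [s1 t1] : 0 < 1 + r i `^ s /\ 0 < 1 + r i `^ t by split; lra.
by rewrite ltr_pdivrMr // mulrAC ltr_pdivlMr //; lra.
Qed.

Lemma critical_sum_continuous : continuous (critical_sum r).
Proof.
move=> s; rewrite /critical_sum; apply: cvg_big => [|i _]; first exact: add_continuous.
have cu : (fun t => r i `^ t) @ s --> r i `^ s.
  have -> : (fun t => r i `^ t) = (fun t => expR (t * ln (r i))).
    by apply/funext => t; rewrite powR_simplexE.
  rewrite powR_simplexE; apply: continuous_cvg; first exact: continuous_expR.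
  by apply: cvgM => //; apply: cvg_cst.
apply: cvgM => //; apply: cvgV; first by rewrite gt_eqF // ltr_wpDr ?powR_ge0.
by apply: cvgD => //; apply: cvg_cst.
Qed.

Lemma critical_exponent_exists : exists2 s, 0 < s < 1 & critical_sum r s = 2^-1.
Proof.
have [sum_r r_gt0] := r_simplex.
have f0 : 2^-1 < critical_sum r 0.
  rewrite /critical_sum (eq_bigr (fun=> 2^-1)) => [|i _]; last first.
    by rewrite powRr0 mul1r.
  rewrite sumr_const card_ord -[ltRHS]mulr_natr ltr_pMr ?invr_gt0 //.
  by rewrite ltr1n.
(* Each [r i / (1 + r i)] is below [r i], and the [r i] sum to 1/2. *)
have f1 : critical_sum r 1 < 2^-1.
  rewrite -sum_r; apply: ltr_sum => [|i _].
    by apply/hasP; exists (Ordinal (ltnW n_gt1)) => //; rewrite mem_index_enum.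
  rewrite powRr1 ?ltW // ltr_pdivrMr ?addr_gt0 // ltr_pMr //.
  by rewrite ltrDl.
have [||s] := @IVT R (critical_sum r) 0 1 2^-1 ler01.
- exact/continuous_subspaceT/critical_sum_continuous.
- by rewrite ge_min le_max (ltW f0) (ltW f1) orbT.
rewrite in_itv /= => /andP[s0 s1] fs; exists s => //.
rewrite !lt_neqAle s0 s1 !andbT.
by apply/andP; split; apply/eqP => es; move: f0 f1; rewrite ?es -?fs -?es ltxx.
Qed.

End CriticalExponent.

(** * Finite counting and upper limits at infinity *)

Lemma counting_seq (R : realType) (T : choiceType) (w : seq T) : uniq w ->
  counting [set` w] = (size w)%:R%:E :> \bar R.
Proof.
move=> uw; rewrite /counting asboolT; last exact: finite_seq.
have -> : [set` w] = [set` [fset x in w]%fset].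
  by apply/seteqP; split=> x /=; rewrite inE.
by rewrite set_fsetK card_fseq undup_id.
Qed.

(** For the upper bound, one neighbourhood where [c2 / t] is small suffices; for the lower bound,
    every neighbourhood of infinity contains a [t] with [c1 / t] small. *)
Lemma limf_esup_pinfty (R : realType) (f : R -> \bar R) (s c1 c2 : R) :
  (forall t, 0 < t -> ((s + c1 / t)%:E <= f t <= (s + c2 / t)%:E)%E) ->
  limf_esup f (pinfty_nbhs R) = s%:E.
Proof.
move=> fE.
have small (c e : R) : 0 < e -> \forall t \near pinfty_nbhs R, 0 < t /\ `|c / t| <= e.
  move=> e0; near=> t; have t0 : 0 < t by near: t; apply: nbhs_pinfty_gt.
  split=> //; rewrite normrM normfV (gtr0_norm t0) ler_pdivrMr //.
  rewrite mulrC -ler_pdivrMr //; near: t.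
apply/eqP; rewrite eq_le /limf_esup; apply/andP; split.
  apply/lee_addgt0Pr => e e0; apply: ge_ereal_inf.
  eexists; first by exists [set t | 0 < t /\ `|c2 / t| <= e]; [exact: small|].
  apply/ereal_supP => _ /= [t [t0 te] <-].
  have /andP[_ /le_trans->//] := fE _ t0.
  by rewrite -EFinD lee_fin lerD2l (le_trans _ te) // ler_norm.
apply/ereal_infP => _ [V FV <-]; apply/lee_addgt0Pr => e e0.
have [t [Vt [t0 te]]] := filter_ex (filterI FV (small c1 _ e0)).
have ft : (f t <= ereal_sup [set f x | x in V])%E.
  by apply: ereal_sup_ubound; exists t.
have /andP[/le_trans/(_ ft) + _] := fE _ t0.
move=> /(leeD2r e%:E); apply: le_trans; rewrite -EFinD lee_fin.
by move: te; rewrite ler_norml => /andP[]; lra.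
Unshelve. all: by end_near.
Qed.

(** * Exponential growth of Cayley balls *)

Section BallGrowth.
Variables (R : realType) (n : nat) (r : 'I_n -> R).
Hypothesis r_simplex : simplex r.
Hypothesis n_gt1 : (1 < n)%N.

Let l0 : letter n := (Ordinal (ltnW n_gt1), false).
(** Words of length at most [t] have at most [t / ln 2] letters, so this fuel lists them all. *)
Let depth (t : R) : nat := (Num.trunc (t / ln 2)).+1.

Let ln2_gt0 : 0 < ln 2 :> R. Proof. by rewrite ln_gt0 // ltr1n. Qed.

Lemma lt_depth t : t < (depth t)%:R * ln 2.
Proof. by rewrite -ltr_pdivrMr // truncnS_gt. Qed.

(** The first letter of a nonempty reduced word can serve as its own predecessor, not being its own
    inverse. *)
Lemma reducedP (w : seq (letter n)) :
  reflect (exists l, path (fun a b => b != linv a) l w) (reduced w).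
Proof.
apply: (iffP idP) => [|[l]]; last exact: path_sorted.
by case: w => [|m w] rw; [exists l0|exists m; rewrite /= linv_neq].
Qed.

(** The ball is the union of the lists over all letters [l]: a single list bounds it below and their
    total size above. The lists overlap, hence [undup]. *)
Lemma cay_ball_counting t :
  exists2 N : nat, counting (cay_ball r t) = N%:R%:E :> \bar R &
    (size (short_words r (depth t) l0 t) <= N <=
     \sum_l size (short_words r (depth t) l t))%N.
Proof.
pose S := [seq w | l <- enum {: letter n}, w <- short_words r (depth t) l t].
have memS w : (w \in undup S) = reduced w && (word_length r w <= t).
  rewrite mem_undup; apply/allpairsPdep/andP => [[l [v []]]|[/reducedP[l lw] wt]].
    rewrite (mem_short_words r_simplex) => _ /and3P[lv _ vt] ->.
    by split=> //; apply/reducedP; exists l.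
  exists l, w; rewrite mem_enum (mem_short_words r_simplex) lw wt andbT.
  split=> //=; rewrite -(ltr_nat R) -(ltr_pM2r ln2_gt0).
  exact: le_lt_trans (size_le_word_length r_simplex w) (le_lt_trans wt (lt_depth t)).
pose G : seq (freegroup n) := pmap insub (undup S).
have ballE : cay_ball r t = [set` G].
  apply/seteqP; split=> g /=;
    by rewrite /cay_ball /= (cay_dist_word r_simplex) mem_pmap_sub memS fwordP.
have uG : uniq G by rewrite pmap_sub_uniq // undup_uniq.
exists (size G); first by rewrite ballE counting_seq.
have -> : size G = size (undup S).
  rewrite size_pmap_sub; apply/eqP; rewrite -all_count; apply/allP => w.
  by rewrite memS => /andP[].
apply/andP; split.
  apply: uniq_leq_size => [|w]; first exact: short_words_uniq.
  rewrite (mem_short_words r_simplex) memS => /and3P[lw _ ->].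
  by rewrite andbT; apply/reducedP; exists l0.
apply: leq_trans (size_undup _) _.
by rewrite size_allpairs_dep sumnE big_map big_enum.
Qed.

Lemma cay_ball_growth s : 0 < s -> critical_sum r s = 2^-1 ->
  exists c1 c2 : R, [/\ 0 < c1, 0 < c2 & forall t, 0 < t ->
    exists2 N : nat, counting (cay_ball r t) = N%:R%:E :> \bar R &
      c1 * expR (s * t) <= N%:R <= c2 * expR (s * t)].
Proof.
move=> s0 crit; pose D := renewal_shift R n.
have D0 : 0 < D := renewal_shift_gt0 R n_gt1.
have D1 : D <= 1 by rewrite invf_le1 ?ltr0n ?ler1n; lia.
pose E := expR (s * \sum_i - ln (r i)).
(* As [D <= 1 <= N], the shifted count is at most [2 * N], and [shadow] is at least 1/2, whence
   [D / 4]. The second constant adds up the bounds of [short_words_le] over all letters, with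
   [shadow] at most 1. *)
exists (4^-1 * D), (\sum_(l : letter n) 2 * D * E); split.
- by rewrite mulr_gt0.
- rewrite sumr_const -[ltRHS]mulr_natr pmulr_rgt0 ?mulr_gt0 ?expR_gt0 // ltr0n.
  by apply/card_gt0P; exists l0.
move=> t t0; have [N NE /andP[N1 N2]] := cay_ball_counting t; exists N => //.
have e0 : 0 < expR (s * t) by apply: expR_gt0.
apply/andP; split.
  have := short_words_ge r_simplex s0 crit n_gt1 l0 (lt_depth t).
  have /andP[q1 _] := shadow_bounds r_simplex s0 l0.
  have N0 : 1 <= (size (short_words r (depth t) l0 t))%:R :> R.
    by rewrite ler1n size_short_words ?ltW.
  have NN : (size (short_words r (depth t) l0 t))%:R <= N%:R :> R.
    by rewrite ler_nat.
  rewrite -/D => h.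
  have : D * expR (s * t) * 2^-1 <= D * expR (s * t) * shadow r s l0.
    by rewrite ler_pM2l // mulr_gt0.
  lra.
rewrite mulr_suml.
apply: le_trans (_ : \sum_l (size (short_words r (depth t) l t))%:R <= _).
  by rewrite -natr_sum ler_nat.
have tM : - \sum_i - ln (r i) <= t.
  apply: le_trans (ltW t0); rewrite oppr_le0 sumr_ge0 // => i _.
  exact: edge_ge0.
apply: ler_sum => l _.
have := short_words_le r_simplex s0 crit n_gt1 (depth t) l (t := t).
rewrite -/D -/E => /(_ tM) h.
have /andP[_ q1] := shadow_bounds r_simplex s0 l.
have : 2 * D * E * expR (s * t) * shadow r s l <= 2 * D * E * expR (s * t).
  by rewrite ger_pMr // !mulr_gt0 // expR_gt0.
lra.
Qed.

Lemma poincare_exponentE s : 0 < s -> critical_sum r s = 2^-1 ->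
  poincare_exponent r = s%:E.
Proof.
move=> s0 crit; have [c1 [c2 [c10 c20 grow]]] := cay_ball_growth s0 crit.
apply: (@limf_esup_pinfty _ _ _ (ln c1) (ln c2)) => t t0.
have [N -> /andP[N1 N2]] := grow _ t0.
have N0 : 0 < N%:R :> R by apply: lt_le_trans N1; rewrite mulr_gt0 ?expR_gt0.
have lnE c : 0 < c -> s + ln c / t = ln (c * expR (s * t)) / t.
  by move=> c0; rewrite lnM ?posrE ?expR_gt0 // expRK; field; rewrite gt_eqF.
rewrite lne_EFin // -EFinM !lee_fin !lnE // !ler_pM2r ?invr_gt0 //.
by rewrite !ler_ln ?posrE ?mulr_gt0 ?expR_gt0 ?N1.
Qed.

End BallGrowth.

Theorem theorem1p2 (R : realType) (n : nat) (r : 'I_n -> R) :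
  (2 <= n)%N -> simplex r ->
  exists s : R,
    [/\ poincare_exponent r = s%:E,
        lambda (powmap r s) = 0,
        0 < s < 1,
        sym_equation r s
      & forall s' : R, 0 < s' < 1 -> sym_equation r s' -> s' = s].
Proof.
move=> n_gt1 r_simplex; have [_ r_gt0] := r_simplex.
have [s s01 crit] := critical_exponent_exists r_simplex n_gt1.
have /andP[s0 s1] := s01.
exists s; split=> //.
- exact: poincare_exponentE.
- apply: lambda_eq0 => [i|i|]; rewrite /powmap ?powR_gt0 //.
  rewrite (powR_simplexE r_simplex) expR_lt1 pmulr_rlt0 // ln_lt0 //.
  by rewrite r_gt0 simplex_lt1.
- exact/sym_equationP.
- move=> s' _ /(sym_equationP r_simplex) crit'.
  have decr := critical_sum_decreasing r_simplex n_gt1.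
  by case: (ltgtP s' s) => // /decr; rewrite crit crit' ltxx.
Qed.
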